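(* Let $\mathcal H_1,\mathcal H_2,\mathcal D_S,\mathcal D_2,\mathcal D_{-S},\mathcal D_{-1},\mathcal D_{-2}$ be complex Hilbert spaces and $A,B,C,D_0,D$ operators satisfying assumptions (a)--(c) of the context, and let $\Theta\subset\mathbb C$, the operator matrix $\mathcal A_0$ in $\mathcal H_1\oplus\mathcal H_2$ and the operator family $S_0(\lambda)$, $\lambda\in\Theta$, in $\mathcal H_1$ be as in the context. Then $$\sigma_{\mathrm p}(\mathcal A_0)\cap\rho(D_0)\cap\Theta=\sigma_{\mathrm p}(S_0(\cdot))\cap\rho(D_0).$$
   Context: Notation. $\mathcal B(\mathcal G_1,\mathcal G_2)$ is the space of everywhere defined bounded linear operators between Hilbert spaces; $\mathcal C(\mathcal G)$ is the set of closed (not necessarily densely defined) linear operators in $\mathcal G$; $\rho,\sigma_{\mathrm p}$ denote resolvent set and point spectrum. For a linear operator $T$ in $\mathcal G$, $\operatorname{coker}T:=(\operatorname{ran}T)^\perp$. For $T\in\mathcal C(\mathcal G)$ with closed range, the generalised inverse $T^\#\in\mathcal B(\mathcal G)$ is defined by $T^\#x=(T|_{\operatorname{dom}T\cap(\ker T)^\perp})^{-1}x$ for $x\in\operatorname{ran}T$ and $T^\#x=0$ for $x\in\operatorname{coker}T$. $T_1\subset T_2$ means $T_2$ extends $T_1$. Assumptions. (a) $\mathcal D_S\subset\mathcal H_1\subset\mathcal D_{-S}$ and $\mathcal D_2\subset\mathcal H_2\subset\mathcal D_{-2}$, where all these canonical embeddings are continuous with dense range; moreover $\mathcal D_{-S}\subset\mathcal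 D_{-1}$ is continuously embedded. (b) $A\in\mathcal B(\mathcal D_S,\mathcal D_{-1})$, $B\in\mathcal B(\mathcal D_2,\mathcal D_{-1})$, $C\in\mathcal B(\mathcal D_S,\mathcal D_{-2})$. (c) $D_0\in\mathcal C(\mathcal H_2)$, $\operatorname{dom}D_0\subset\mathcal D_2$ is dense in $\mathcal D_2$, and there is an extension $D_0\subset D\in\mathcal B(\mathcal D_2,\mathcal D_{-2})$. Definitions. With $\mathcal D:=\mathcal D_S\oplus\mathcal D_2$, $\mathcal D_-:=\mathcal D_{-1}\oplus\mathcal D_{-2}$, $\mathcal H:=\mathcal H_1\oplus\mathcal H_2$, put $\mathcal A:=\begin{pmatrix}A&B\\C&D\end{pmatrix}\in\mathcal B(\mathcal D,\mathcal D_-)$ and $\mathcal A_0:=\mathcal A|_{\operatorname{dom}\mathcal A_0}$, $\operatorname{dom}\mathcal A_0:=\{(f,g)\in\mathcal D:\mathcal A(f,g)\in\mathcal H\}$, an operator in $\mathcal H$. $\Theta\subset\mathbb C$ is a set such that for every $\lambda\in\Theta$ the range of $D_0-\lambda$ is closed in $\mathcal H_2$ and there exists an extension $(D_0-\lambda)^\#\subset D^\ddagger(\lambda)\in\mathcal B(\mathcal D_{-2},\mathcal D_2)$ (fixed for each $\lambda$). For $\lambda\in\Theta$, $$S(\lambda):=A-\lambda-BD^\ddagger(\lambda)C\in\mathcal B(\mathcal D_S,\mathcal D_{-1}),$$ $S_0(\lambda):=S(\lambda)|_{\operatorname{dom}S_0(\lambda)}$, $\operatorname{dom}S_0(\lambda):=\{f\in\mathcal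 D_S:S(\lambda)f\in\mathcal H_1\}$, an operator in $\mathcal H_1$. The point spectrum of the family is $\sigma_{\mathrm p}(S_0(\cdot)):=\{\lambda\in\Theta:0\in\sigma_{\mathrm p}(S_0(\lambda))\}$. *)

(* Defs.v *)
From HB Require Import structures.
From mathcomp Require Import all_boot all_order all_algebra.
From mathcomp Require Import all_classical all_reals topology normedtype.
From mathcomp Require Export complex.

Set Implicit Arguments.
Unset Strict Implicit.
Unset Printing Implicit Defensive.

Import Order.TTheory GRing.Theory Num.Theory.
Import numFieldNormedType.Exports.

Local Open Scope classical_set_scope.
Local Open Scope ring_scope.

(* Used with K := R[i] only. The inner product is linear in its first argument
   and conjugate-linear in its second one. *)
HB.mixin Record isHilbert (K : numClosedFieldType) H
    & CompleteNormedModule K H := {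
  inner : H -> H -> K;
  innerDl : forall (a : K) (x y z : H),
    inner (a *: x + y) z = a * inner x z + inner y z;
  innerC : forall x y : H, inner x y = (inner y x)^*;
  innerxx : forall x : H, inner x x = `|x| ^+ 2
}.

#[short(type="hilbertType")]
HB.structure Definition Hilbert (K : numClosedFieldType) :=
  {H of isHilbert K H & CompleteNormedModule K H}.

Definition ortho (K : numClosedFieldType) (G : hilbertType K) (M : set G) :
    set G :=
  [set x | forall y, M y -> inner x y = 0].

Record boundedOp (K : numFieldType) (U V : normedModType K) := BoundedOp {
  bop :> {linear U -> V};
  bop_bounded : exists M : K, forall x : U, `|bop x| <= M * `|x|
}.

(* A continuous embedding of U into V, in place of an inclusion of U in V. *)
Record embedding (K : numFieldType) (U V : normedModType K) := Embedding {
  emb :> {linear U -> V};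
  emb_continuous : continuous emb;
  emb_inj : injective emb
}.

(* A linear operator in G with an arbitrary subspace of G as its domain, given
   by its graph: T (x, y) means that x is in dom T and T x = y. *)
Record linop (K : numFieldType) (G : lmodType K) := Linop {
  graph :> G * G -> Prop;
  graph0 : graph (0, 0);
  graph_linear : forall (a : K) (p q : G * G),
    graph p -> graph q -> graph (a *: p + q);
  graph_fun : forall x y z : G, graph (x, y) -> graph (x, z) -> y = z
}.

Section Operators.
Context {K : numFieldType} {G : lmodType K}.
Implicit Types T : linop G.

Definition dom T : set G := [set x | exists y, T (x, y)].
Definition ran T : set G := [set y | exists x, T (x, y)].
Definition ker T : set G := [set x | T (x, 0)].

Section OpShift.
Variables (T : linop G) (lam : K).

Definition opshift_graph : set (G * G) := [set p | T (p.1, p.2 + lam *: p.1)].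

Fact opshift_graph0 : opshift_graph (0, 0).
Proof. by rewrite /opshift_graph /= scaler0 addr0; exact: graph0. Qed.

Fact opshift_graph_linear (a : K) (p q : G * G) :
  opshift_graph p -> opshift_graph q -> opshift_graph (a *: p + q).
Proof.
case: p q => [x y] [x' y'] /= Tp Tq; rewrite /opshift_graph /=.
have := graph_linear a Tp Tq; congr (graph T (_, _)) => /=.
by rewrite !scalerDr !scalerA addrACA [lam * a]mulrC.
Qed.

Fact opshift_graph_fun (x y z : G) :
  opshift_graph (x, y) -> opshift_graph (x, z) -> y = z.
Proof. by move=> /graph_fun Ty /Ty /addIr. Qed.

(* T - lam *)
Definition opshift : linop G :=
  Linop opshift_graph0 opshift_graph_linear opshift_graph_fun.

End OpShift.

Definition point_spectrum T : set K :=
  [set lam | exists2 x, x != 0 & ker (opshift T lam) x].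

End Operators.

Definition closed_op (K : numFieldType) (G : normedModType K) (T : linop G) :=
  closed [set p | T p].

(* T - lam is a bijection from dom T onto G with bounded inverse F. *)
Definition resolvent_set (K : numFieldType) (G : normedModType K)
    (T : linop G) : set K :=
  [set lam | exists F : boundedOp G G,
     forall x y : G, opshift T lam (x, y) <-> F y = x].

Section GeneralisedInverse.
Context {K : numClosedFieldType} {G : hilbertType K}.
Variable T : linop G.

Definition coker : set G := ortho (ran T).

(* The pairs (y + z, u) with y in ran T, z in coker T and u the preimage of y
   under the restriction of T to the orthogonal complement of ker T. When T is
   closed with closed range, this is the graph of an everywhere defined bounded
   operator. *)
Definition ginv_graph : set (G * G) :=
  [set p | exists y z, [/\ p.1 = y + z, coker z, ortho (ker T) p.2 & T (p.2, y)]].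

Let ortho_linear (M : set G) (a : K) (x y : G) :
  ortho M x -> ortho M y -> ortho M (a *: x + y).
Proof. by move=> Mx My w Mw; rewrite innerDl Mx// My// mulr0 addr0. Qed.

Let ortho0 (M : set G) : ortho M 0.
Proof.
by move=> w _; have := innerDl (-1) w w w; rewrite scaleN1r addNr mulN1r addNr.
Qed.

Let ortho_self (M : set G) (x : G) : ortho M x -> M x -> x = 0.
Proof.
move=> Mx /Mx; rewrite innerxx => /eqP.
by rewrite expf_eq0 /= normr_eq0 => /eqP.
Qed.

Let graphB (x y x' y' : G) : T (x, y) -> T (x', y') -> T (x - x', y - y').
Proof.
move=> Txy Txy'; have := graph_linear (-1) Txy' Txy.
by congr (graph T (_, _)) => /=; rewrite scaleN1r addrC.
Qed.

Fact ginv_graph0 : ginv_graph (0, 0).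
Proof.
exists 0, 0; split => /=; last exact: graph0.
- by rewrite addr0.
- exact: ortho0.
- exact: ortho0.
Qed.

Fact ginv_graph_linear (a : K) (p q : G * G) :
  ginv_graph p -> ginv_graph q -> ginv_graph (a *: p + q).
Proof.
case: p q => [x u] [x' u'] [y [z [/= -> cz ou Tu]]] [y' [z' [/= -> cz' ou' Tu']]].
exists (a *: y + y'), (a *: z + z'); split => /=.
- by rewrite scalerDr addrACA.
- exact: ortho_linear.
- exact: ortho_linear.
- exact: graph_linear Tu Tu'.
Qed.

Fact ginv_graph_fun (x u v : G) :
  ginv_graph (x, u) -> ginv_graph (x, v) -> u = v.
Proof.
move=> [y [z [/= -> cz ou Tu]]] [y' [z' [/= E cz' ov Tv]]].
have Tuv := graphB Tu Tv.
have Ey : y - y' = z' - z.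
  by apply/eqP; rewrite subr_eq addrAC -subr_eq opprK addrC E addrC.
have y0 : y - y' = 0.
  apply: (@ortho_self (ran T)); last by exists (u - v).
  by rewrite Ey -scaleN1r addrC; exact: ortho_linear.
apply/eqP; rewrite -subr_eq0; apply/eqP; apply: (@ortho_self (ker T)).
  by rewrite -scaleN1r addrC; exact: ortho_linear.
by rewrite /ker /= -[X in T (_, X)]y0.
Qed.

Definition ginv : linop G :=
  Linop ginv_graph0 ginv_graph_linear ginv_graph_fun.

End GeneralisedInverse.

(* For U and G included in W (U in G through i, G in W through k), the
   restriction of L : U -> W to {u in U | L u in G}, as an operator in G. *)
Section Part.
Context {K : numFieldType} {U G W : lmodType K}.
Variables (i : {linear U -> G}) (k : {linear G -> W}) (L : {linear U -> W}).
Hypotheses (i_inj : injective i) (k_inj : injective k).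

Definition part_graph : set (G * G) :=
  [set p | exists2 u, i u = p.1 & L u = k p.2].

Fact part_graph0 : part_graph (0, 0).
Proof. by exists 0; rewrite /= !linear0. Qed.

Fact part_graph_linear (a : K) (p q : G * G) :
  part_graph p -> part_graph q -> part_graph (a *: p + q).
Proof.
move=> [u iu Lu] [v iv Lv].
by exists (a *: u + v); rewrite /= linearP ?iu ?iv// linearP Lu Lv.
Qed.

Fact part_graph_fun (x y z : G) :
  part_graph (x, y) -> part_graph (x, z) -> y = z.
Proof.
move=> [u /= iu Lu] [v /= iv Lv]; apply: k_inj; rewrite -Lu -Lv.
by congr (L _); apply: i_inj; rewrite iu.
Qed.

Definition part : linop G :=
  Linop part_graph0 part_graph_linear part_graph_fun.

End Part.

Section DirectSum.
Context {K : numFieldType} {U1 U2 V1 V2 : lmodType K}.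
Variables (f : {linear U1 -> V1}) (g : {linear U2 -> V2}).

Definition dsum (p : U1 * U2) : V1 * V2 := (f p.1, g p.2).

Fact dsum_is_linear : linear dsum.
Proof. by move=> a [x y] [x' y']; rewrite /dsum /= !linearP. Qed.

HB.instance Definition _ :=
  GRing.isLinear.Build K (U1 * U2)%type (V1 * V2)%type _ dsum dsum_is_linear.

Fact dsum_inj : injective f -> injective g -> injective dsum.
Proof. by move=> fI gI [x y] [x' y'] [/fI /= -> /gI /= ->]. Qed.

End DirectSum.

Section BlockMatrix.
Context {K : numFieldType} {U1 U2 V1 V2 : lmodType K}.
Variables (A : {linear U1 -> V1}) (B : {linear U2 -> V1}).
Variables (C : {linear U1 -> V2}) (D : {linear U2 -> V2}).

Definition block (p : U1 * U2) : V1 * V2 :=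
  (A p.1 + B p.2, C p.1 + D p.2).

Fact block_is_linear : linear block.
Proof.
by move=> a [x y] [x' y']; rewrite /block /= !linearP /= !addrA;
  congr (_, _); rewrite /= !scalerDr !addrA; congr (_ + _); rewrite addrAC.
Qed.

HB.instance Definition _ :=
  GRing.isLinear.Build K (U1 * U2)%type (V1 * V2)%type _ block block_is_linear.

End BlockMatrix.

Section OperatorMatrix.
Context {K : numFieldType} {H1 H2 DS D2 DmS Dm1 Dm2 : normedModType K}.
Variables (eS : embedding DS H1) (e1 : embedding H1 DmS).
Variables (eS1 : embedding DmS Dm1).
Variables (e2 : embedding D2 H2) (em2 : embedding H2 Dm2).
Variables (A : boundedOp DS Dm1) (B : boundedOp D2 Dm1).
Variables (C : boundedOp DS Dm2) (D : boundedOp D2 Dm2).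

(* The inclusion of H1 in D_{-1} is the one through D_{-S}. *)
Let e1_inj : injective (eS1 \o e1).
Proof. exact: inj_comp (@emb_inj _ _ _ eS1) (@emb_inj _ _ _ e1). Qed.

(* Direct sums are product types; as H1 + H2 only enters through its linear
   structure, the choice of the norm on the product is immaterial. *)
Definition calA0 : linop (H1 * H2)%type :=
  part (i := dsum eS e2) (k := dsum (eS1 \o e1) em2) (block A B C D)
    (dsum_inj (@emb_inj _ _ _ eS) (@emb_inj _ _ _ e2))
    (dsum_inj e1_inj (@emb_inj _ _ _ em2)).

Section Schur.
Variables (Dd : boundedOp Dm2 D2) (lam : K).

(* A - lam - B Dd C, where lam stands for lam times the inclusion of D_S in
   D_{-1} *)
Definition schur (f : DS) : Dm1 :=
  A f - lam *: eS1 (e1 (eS f)) - B (Dd (C f)).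

Fact schur_is_linear : linear schur.
Proof.
move=> a x y; rewrite /schur.
rewrite (linearP A) (linearP eS) (linearP e1) (linearP eS1).
rewrite (linearP C) (linearP Dd) (linearP B) /=.
rewrite [lam *: (_ + _)]scalerDr scalerA [lam * a]mulrC -scalerA !scalerBr.
by rewrite !opprD [a *: A x + _ + _]addrACA [LHS]addrACA.
Qed.

HB.instance Definition _ :=
  GRing.isLinear.Build K DS Dm1 _ schur schur_is_linear.

Definition schur0 : linop H1 :=
  part (k := eS1 \o e1) schur (@emb_inj _ _ _ eS) e1_inj.

End Schur.

Definition schur_point_spectrum (Theta : set K)
    (Dd : K -> boundedOp Dm2 D2) : set K :=
  [set lam | Theta lam /\ point_spectrum (schur0 (Dd lam) lam) 0].

End OperatorMatrix.

(* Main.v *)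
(* Fix lam in Theta and rho(D0). Then D0 - lam is onto with trivial kernel, so
   its generalised inverse is its resolvent. The operators D - lam and Dd lam
   are bounded and invert one another on dense subspaces, hence they invert one
   another. So the second row of (A0 - lam)(f, g) = 0 reads g = - Dd (C f), and
   substituting this into the first row gives S0(lam) f = 0. *)
Require Import Defs.
From mathcomp Require Import all_boot all_order all_algebra.
From mathcomp Require Import all_classical all_reals topology normedtype.

Import Order.TTheory GRing.Theory Num.Theory.
Import numFieldNormedType.Exports.

Local Open Scope classical_set_scope.
Local Open Scope ring_scope.

Set Implicit Arguments.
Unset Strict Implicit.
Unset Printing Implicit Defensive.

(** Points are closed in [V], so [f \- g] vanishes on a closed set; its complement is open and, if
    nonempty, would meet [S]. *)
Lemma dense_eq_continuous (K : numFieldType) (T : topologicalType)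
    (V : normedModType K) (S : set T) (f g : T -> V) :
  dense S -> continuous f -> continuous g -> {in S, f =1 g} -> f =1 g.
Proof.
move=> dS cf cg fg x; apply: contrapT => nfg.
have cl0 : closed [set 0 : V].
  have /accessible_closed_set1 := hausdorff_accessible (@norm_hausdorff K V).
  exact.
have clfg : closed ((f \- g) @^-1` [set 0]).
  apply: preimage_closed cl0 => y _.
  by apply: continuousB; [exact: cf|exact: cg].
have [|y [/= ny Sy]] := dS _ _ (closed_openC clfg).
  by exists x => /= /eqP; rewrite subr_eq0 => /eqP.
by apply: ny; rewrite fg ?inE// subrr.
Qed.

Lemma boundedOp_continuous (K : numFieldType) (U V : normedModType K)
    (L : boundedOp U V) : continuous L.
Proof.
apply/bounded_linear_continuous/linear_boundedP.
have [M LM] := bop_bounded L.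
(* [M] need not be nonnegative, but [M * |x|] dominates a norm, so it equals [|M| * |x|] and every
   [r] above [|M|] is a bound. *)
near=> r => x; have Mx := le_trans (normr_ge0 _) (LM x).
rewrite (le_trans (LM x))// -(ger0_norm Mx) normrM normr_id.
rewrite ler_wpM2r//; near: r; apply: nbhs_pinfty_ge; exact: normr_real.
Unshelve. all: by end_near. Qed.

Lemma ginv_resolvent (K : numClosedFieldType) (G : hilbertType K)
    (T : linop G) (F : G -> G) :
  (forall x y, T (x, y) <-> F y = x) -> forall y, ginv T (y, F y).
Proof.
move=> TF y; exists y, 0; split => /=; [by rewrite addr0| | |exact/TF].
  move=> z _; have := innerDl (-1) z z z.
  by rewrite scaleN1r addNr mulN1r addNr.
(* A kernel vector is [F 0], and [F 0 = 0]; so the kernel is trivial and orthogonality to it is no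
   constraint on [F y]. *)
move=> x /TF <-; have /TF -> := graph0 T.
rewrite innerC; have := innerDl (-1) (F y) (F y) (F y).
by rewrite scaleN1r addNr mulN1r addNr => ->; rewrite conjC0.
Qed.

Section ExtendedResolvent.
Context {K : numClosedFieldType} {H2 D2 Dm2 : hilbertType K}.
Variables (e2 : embedding D2 H2) (em2 : embedding H2 Dm2).
Hypothesis em2_dense : dense (range em2).
Variables (D0 : linop H2) (D : boundedOp D2 Dm2).
Hypotheses (D0_dense : dense (e2 @^-1` dom D0))
  (D_ext : forall (g : D2) (y : H2), D0 (e2 g, y) -> D g = em2 y).
Variables (lam : K) (Dd : boundedOp Dm2 D2).
Hypotheses (Dd_ext : forall x y : H2,
    ginv (opshift D0 lam) (x, y) -> e2 (Dd (em2 x)) = y)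
  (lam_res : resolvent_set D0 lam).

Let Dlam (g : D2) : Dm2 := D g - lam *: em2 (e2 g).

Let Dlam_continuous : continuous Dlam.
Proof.
move=> g; apply: continuousB; first exact: boundedOp_continuous.
apply: continuousZl_tmp.
by apply: continuous_comp; [exact: emb_continuous|exact: emb_continuous].
Qed.

(** On [H2], embedded by [em2], the extension [Dd] acts as the resolvent [F] of [D0] at [lam]. *)
Let e2Dd : exists2 F : H2 -> H2,
  forall x y, opshift D0 lam (x, y) <-> F y = x &
  forall y, e2 (Dd (em2 y)) = F y.
Proof.
have [F TF] := lam_res; exists F => // y.
exact/Dd_ext/ginv_resolvent.
Qed.

(** Both sides are continuous in [w], so it suffices to take [w] in the dense range of [em2], where
    [Dd] is the resolvent. *)
Lemma ext_resolventK (w : Dm2) :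
  D (Dd w) - lam *: em2 (e2 (Dd w)) = w.
Proof.
have [F TF eF] := e2Dd.
apply: (@dense_eq_continuous _ _ _ _ (Dlam \o Dd) id em2_dense).
- move=> x; apply: continuous_comp; first exact: boundedOp_continuous.
  exact: Dlam_continuous.
- by move=> x; exact: cvg_id.
move=> _ /set_mem[y _ <-]; have /TF := erefl (F y).
rewrite /opshift /opshift_graph /= /Dlam -eF => /D_ext ->.
by rewrite linearD linearZ addrK.
Qed.

(** Here density of the domain of [D0] in [D2] is what counts: for such [g] the argument of [Dd]
    lies in [H2]. *)
Lemma resolvent_extK (g : D2) :
  Dd (D g - lam *: em2 (e2 g)) = g.
Proof.
have [F TF eF] := e2Dd.
apply: (@dense_eq_continuous _ _ _ _ (Dd \o Dlam) id D0_dense).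
- move=> x; apply: continuous_comp; first exact: Dlam_continuous.
  exact: boundedOp_continuous.
- by move=> x; exact: cvg_id.
move=> {}g /set_mem[y D0y] /=; rewrite /Dlam (D_ext D0y) -linearZ -linearB /=.
(* Seen in [H2], the claim is that [F] sends [y - lam *: e2 g] back to [e2 g]. *)
apply: (@emb_inj _ _ _ e2); rewrite eF; apply/TF.
by rewrite /opshift /opshift_graph /= subrK.
Qed.

End ExtendedResolvent.

(** Purely algebraic elimination of the second component: the left inverse property of [Dd]
    determines [g] from [f], the right inverse property gives the converse. *)
Lemma point_spectrum_schur (K : numFieldType)
    (H1 H2 DS D2 DmS Dm1 Dm2 : normedModType K)
    (eS : embedding DS H1) (e1 : embedding H1 DmS) (eS1 : embedding DmS Dm1)
    (e2 : embedding D2 H2) (em2 : embedding H2 Dm2)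
    (A : boundedOp DS Dm1) (B : boundedOp D2 Dm1)
    (C : boundedOp DS Dm2) (D : boundedOp D2 Dm2)
    (Dd : boundedOp Dm2 D2) (lam : K) :
    (forall w, D (Dd w) - lam *: em2 (e2 (Dd w)) = w) ->
    (forall g, Dd (D g - lam *: em2 (e2 g)) = g) ->
  point_spectrum (calA0 eS e1 eS1 e2 em2 A B C D) lam <->
  point_spectrum (schur0 eS e1 eS1 A B C Dd lam) 0.
Proof.
move=> DDd DdD.
have lam1 x : eS1 (e1 (lam *: x)) = lam *: eS1 (e1 x) by rewrite !linearZ_LR.
split=> [[p + [[f g] /= p_def []]]|[p + [f /= p_def]]].
  rewrite -{}p_def /= !add0r lam1 linearZ_LR => p_neq0 Afg Cfg.
  have g_def : g = - Dd (C f).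
    by rewrite -[LHS]DdD -Cfg opprD addrCA subrr addr0 linearN.
  exists (eS f).
    (* Since [g] is a linear function of [f], a vanishing [f] would make the whole eigenvector
       vanish. *)
    apply: contraNneq p_neq0 => eSf0.
    have f0 : f = 0 by apply: (@emb_inj _ _ _ eS); rewrite eSf0 linear0.
    by rewrite g_def f0 /dsum /= !linear0.
  exists f => //=; rewrite /schur scale0r addr0 !linear0.
  by rewrite addrAC -[- B _]linearN -g_def Afg subrr.
rewrite -{}p_def /schur scale0r addr0 !linear0 => p_neq0 Sf.
(* The second component is the one forced by the second row. *)
exists (eS f, e2 (- Dd (C f))).
  by apply: contraNneq p_neq0 => -[-> _].
exists (f, - Dd (C f)) => //=; rewrite /block /dsum /= !add0r.
congr (_, _).
  by apply/eqP; rewrite -subr_eq0 linearN lam1 addrAC; exact/eqP.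
rewrite -{1}(DDd (C f)) linearZ_LR !linearN /=.
by rewrite addrAC subrr add0r.
Qed.

Theorem corollary3p5 (R : realType)
    (H1 H2 DS D2 DmS Dm1 Dm2 : hilbertType R[i])
    (eS : embedding DS H1) (e1 : embedding H1 DmS)
    (eS1 : embedding DmS Dm1)
    (e2 : embedding D2 H2) (em2 : embedding H2 Dm2)
    (eS_dense : dense (range eS)) (e1_dense : dense (range e1))
    (e2_dense : dense (range e2)) (em2_dense : dense (range em2))
    (A : boundedOp DS Dm1) (B : boundedOp D2 Dm1) (C : boundedOp DS Dm2)
    (D0 : linop H2) (D0_closed : closed_op D0)
    (D0_dom : dom D0 `<=` range e2) (D0_dense : dense (e2 @^-1` dom D0))
    (D : boundedOp D2 Dm2)
    (D_ext : forall (g : D2) (y : H2), D0 (e2 g, y) -> D g = em2 y)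
    (Theta : set R[i])
    (D0_ran : forall lam, Theta lam -> closed (ran (opshift D0 lam)))
    (Dd : R[i] -> boundedOp Dm2 D2)
    (Dd_ext : forall lam, Theta lam -> forall x y : H2,
       ginv (opshift D0 lam) (x, y) -> e2 (Dd lam (em2 x)) = y) :
  point_spectrum (calA0 eS e1 eS1 e2 em2 A B C D)
    `&` resolvent_set D0 `&` Theta =
  schur_point_spectrum eS e1 eS1 A B C Theta Dd `&` resolvent_set D0.
Proof.
have schurP l : Theta l -> resolvent_set D0 l ->
    point_spectrum (calA0 eS e1 eS1 e2 em2 A B C D) l <->
    point_spectrum (schur0 eS e1 eS1 A B C (Dd l) l) 0.
  move=> tl rl; apply: point_spectrum_schur.
    exact (ext_resolventK em2_dense D_ext (Dd_ext l tl) rl).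
  exact (resolvent_extK D0_dense D_ext (Dd_ext l tl) rl).
apply/seteqP; split=> [l [[pl rl] tl]|l [[tl pl] rl]].
  by split=> //; split=> //; apply/schurP.
by split=> //; split=> //; apply/schurP.
Qed.
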